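(* Let $K$ be a field, $n\ge1$, and let $G=(G_0,G_1)$ be a finite undirected graph with vertex set $G_0=\{1,\dots,n\}$, possibly with loops and multiple edges, and with no isolated vertices. Let $\Gamma(G)$ be the Brauer configuration associated to $G$, let $\Lambda_{\Gamma(G)}$ be its Brauer configuration algebra over $K$, and let $A_G$ be the canonical symmetric algebra with radical cubed zero associated to $G$. Then $\Lambda_{\Gamma(G)}$ and $A_G$ are isomorphic as $K$-algebras.
   Context: Canonical algebra $A_G$. Let $\mathcal Q_G$ be the quiver with vertex set $\{1,\dots,n\}$ and, for each non-loop edge $e$ of $G$ with endpoints $i\ne j$, two arrows $a\colon i\to j$ and $a'\colon j\to i$, and for each loop $e$ of $G$ at $i$, one loop $b$ at $i$. The paths $aa'$, $a'a$ (for each non-loop edge) and $b^2$ (for each loop) are called distinguished. Let $I_G\subseteq K\mathcal Q_G$ be the ideal generated by: all $p-q$ with $p,q$ distinguished paths having the same start and end vertices; all $aba$ for arrows $a,b$ with $ab$ a distinguished path; all non-distinguished paths of length $2$. Then $A_G=K\mathcal Q_G/I_G$. Brauer configuration $\Gamma(G)$. The polygons are $V_1,\dots,V_n$, one for each vertex of $G$. A leaf of $G$ is a vertex $i$ incident with exactly one edge $e$, where $e$ is not a loop; $e$ is then the leaf edge associated to $i$. The vertices of $\Gamma(G)$ are the edges of $G$, together with an extra vertex $(e,i)$ for each leaf $i$ with leaf edge $e$, and an extra vertex $(e,i)$ for each connected component of $G$ consisting of a single vertex $i$ with a single loop $e$. If $i$ is a leaf with leaf edge $e$, or if $i$ with the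 loop $e$ is a connected component of the kind just described, then $V_i=\{e,(e,i)\}$; otherwise $V_i$ is the set of all edges of $G$ having $i$ as an endpoint (a loop at $i$ is contained once in $V_i$). The multiplicity is $\mu(e)=2$ if $e$ is a loop, $\mu(e)=1$ if $e$ is a non-loop edge, and $\mu((e,i))=1$. Each vertex of $\Gamma(G)$ lies in at most two polygons, so the orientation is unique. Brauer configuration (general). A Brauer configuration $\Gamma=(\Gamma_0,\Gamma_1,\mu,\mathfrak o)$ consists of a finite set $\Gamma_0$ of vertices, a finite collection $\Gamma_1$ of labelled finite multisets of elements of $\Gamma_0$, called polygons (differently labelled polygons may be equal as multisets), a multiplicity function $\mu\colon\Gamma_0\to\mathbb Z_{>0}$, and an orientation $\mathfrak o$. For $\alpha\in\Gamma_0$, $V\in\Gamma_1$, $\mathrm{occ}(\alpha,V)$ is the number of times $\alpha$ occurs in $V$, and $\mathrm{val}(\alpha)=\sum_{V\in\Gamma_1}\mathrm{occ}(\alpha,V)$. An orientation is a choice, for each $\alpha\in\Gamma_0$, of a cyclic ordering of the list of polygons containing $\alpha$, where each $V$ is listed $\mathrm{occ}(\alpha,V)$ times (the different occurrences being distinguished). It is required that: every vertex lies in at least one polygon; every polygon has at least two vertices (counted with multiplicity); every polygon contains a vertex $\alpha$ with $\mathrm{val}(\alpha)\mu(\alpha)>1$. A vertex $\alpha$ is truncated if $\mathrm{val}(\alpha)\mu(\alpha)=1$, and nontruncated otherwise. Quiver. $\mathcal Q_\Gamma$ has one vertex $v$ for each polygon $V\in\Gamma_1$. For a nontruncated $\alpha$,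 the cyclically ordered list $V_1<\dots<V_t$ ($t=\mathrm{val}(\alpha)$, $V_{t+1}=V_1$) given by $\mathfrak o$ is the successor sequence at $\alpha$; for each $r=1,\dots,t$ there is an arrow $a_r$ from the vertex $v_r$ associated to $V_r$ to the vertex $v_{r+1}$ associated to $V_{r+1}$ (a loop if $t=1$). The arrows obtained for different $\alpha$ and different $r$ are distinct, and these are all arrows of $\mathcal Q_\Gamma$. Paths are written from left to right. Special cycles. With this notation put $C_j=a_ja_{j+1}\cdots a_ta_1\cdots a_{j-1}$. If $V$ is a polygon containing $\alpha$, the special $\alpha$-cycles at $v$ are the $C_j$ with $V_j=V$. Algebra. $\Lambda_\Gamma=K\mathcal Q_\Gamma/I_\Gamma$, where $I_\Gamma$ is generated by: (type one) all $C^{\mu(\alpha)}-(C')^{\mu(\beta)}$ where, for some polygon $V$, $C$ is a special $\alpha$-cycle at $v$ and $C'$ is a special $\beta$-cycle at $v$, with $\alpha,\beta$ nontruncated vertices of $V$ (possibly $\alpha=\beta$); (type two) all $C^{\mu(\alpha)}a$ where $C$ is a special $\alpha$-cycle and $a$ is the first arrow of $C$; (type three) all paths $ab$ of length two that are not a subpath of any special cycle, except those with $a=b$ a loop associated to a vertex $\alpha$ with $\mathrm{val}(\alpha)=1$ and $\mu(\alpha)>1$. *)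

(* Defs.v *)
From HB Require Import structures.
From mathcomp Require Import all_boot all_fingroup all_algebra.
From mathcomp Require Import finmap multiset boolp freeg.

Set Implicit Arguments.
Unset Strict Implicit.
Unset Printing Implicit Defensive.

Import GRing.Theory.

Local Open Scope ring_scope.

Inductive ideal_generated (R : pzRingType) (S : R -> Prop) : R -> Prop :=
| ideal_gen x of S x : ideal_generated S x
| ideal_0 : ideal_generated S 0
| ideal_add x y of ideal_generated S x & ideal_generated S y :
    ideal_generated S (x + y)
| ideal_mull a x of ideal_generated S x : ideal_generated S (a * x)
| ideal_mulr x a of ideal_generated S x : ideal_generated S (x * a).

Record quiver := Quiver {
  qvert : finType;
  qarrow : finType;
  qsrc : qarrow -> qvert;
  qtgt : qarrow -> qvert
}.

(* A path is a start vertex together with a sequence of consecutive arrows read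
   from left to right; the pair (v, [::]) is the trivial path at v. *)
Section Paths.
Variable Q : quiver.

Fixpoint is_walk (v : qvert Q) (s : seq (qarrow Q)) : bool :=
  if s is a :: s' then (qsrc a == v) && is_walk (qtgt a) s' else true.

Definition walk_end (v : qvert Q) (s : seq (qarrow Q)) : qvert Q :=
  last v [seq qtgt a | a <- s].

Record qpath := QPath {
  qpath_val :> qvert Q * seq (qarrow Q);
  _ : is_walk qpath_val.1 qpath_val.2
}.
HB.instance Definition _ := [isSub for qpath_val].
HB.instance Definition _ := [Choice of qpath by <:].

Definition psrc (p : qpath) : qvert Q := p.1.
Definition ptgt (p : qpath) : qvert Q := walk_end p.1 p.2.

Definition pconcat (p q : qpath) : option qpath :=
  if ptgt p == psrc q then insub (psrc p, p.2 ++ q.2) else None.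

Definition ptriv (v : qvert Q) : qpath :=
  @QPath (v, [::]) isT.

Fact is_walk_arrow (a : qarrow Q) : is_walk (qsrc a) [:: a].
Proof. by rewrite /= eqxx. Qed.

Definition parrow (a : qarrow Q) : qpath :=
  @QPath (qsrc a, [:: a]) (is_walk_arrow a).

Lemma is_walk_cat v s t :
  is_walk v (s ++ t) = is_walk v s && is_walk (walk_end v s) t.
Proof. by elim: s v => //= a s IH v; rewrite IH andbA. Qed.

Lemma walk_end_cat v s t : walk_end v (s ++ t) = walk_end (walk_end v s) t.
Proof. by rewrite /walk_end map_cat last_cat. Qed.

Variant pconcat_spec (p q : qpath) : option qpath -> Prop :=
| PconcatSome r of ptgt p = psrc q & val r = (psrc p, p.2 ++ q.2) :
    pconcat_spec p q (Some r)
| PconcatNone of ptgt p <> psrc q : pconcat_spec p q None.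

Lemma pconcatP p q : pconcat_spec p q (pconcat p q).
Proof.
rewrite /pconcat; case: eqP => [e|]; last by constructor.
case: insubP => [r _ rE|]; first by constructor.
case: p q e => [[v s] /= hs] [[w t] /= ht]; rewrite /ptgt /psrc /= => e.
by rewrite is_walk_cat hs e ht.
Qed.

Lemma pconcatA p q r :
  obind (pconcat p) (pconcat q r) = obind (pconcat^~ r) (pconcat p q).
Proof.
case: (pconcatP q r) => [qr eqr qrE|nqr]; case: (pconcatP p q) => //=.
- move=> pq epq pqE; case: pconcatP => [x _ xE|[]]; last first.
    by rewrite epq /psrc qrE.
  case: pconcatP => [y _ yE|[]]; last first.
    by rewrite -eqr /ptgt pqE /= walk_end_cat -/(ptgt p) epq.
  congr Some; apply: val_inj; rewrite xE yE.
  by rewrite qrE pqE /psrc pqE /= catA.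
- move=> npq; case: pconcatP => // x; rewrite /(psrc qr) qrE => e.
  by case: npq.
- move=> pq epq pqE; case: pconcatP => // x e; case: nqr; rewrite -e.
  by rewrite /(ptgt pq) pqE /= walk_end_cat -/(ptgt p) epq.
Qed.

Lemma pconcat_trivl v p :
  pconcat (ptriv v) p = if psrc p == v then Some p else None.
Proof.
case: pconcatP => [r|] /=; rewrite -[ptgt _]/v; last by case: eqP => // ->.
move=> e rE; rewrite e eqxx; congr Some; apply: val_inj => /=; rewrite rE.
by rewrite -[psrc (ptriv v)]/v e /psrc -surjective_pairing.
Qed.

Lemma pconcat_trivr v p :
  pconcat p (ptriv v) = if ptgt p == v then Some p else None.
Proof.
case: pconcatP => [r|] /=; rewrite -[psrc (ptriv v)]/v; last by case: eqP.
move=> e rE; rewrite e eqxx; congr Some; apply: val_inj => /=; rewrite rE cats0.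
by rewrite /psrc -surjective_pairing.
Qed.

End Paths.

Section PathAlgebraMul.
Variables (K : fieldType) (Q : quiver).

Local Notation A := {freeg (qpath Q) / K}.

Implicit Types (x y z : A) (p q r : qpath Q).

Definition path_elt p : A := << p >>.

Definition opath_elt (o : option (qpath Q)) : A := oapp path_elt 0 o.

Definition pa_mul x y : A :=
  \sum_(p <- dom x) \sum_(q <- dom y)
    (coeff p x * coeff q y) *: opath_elt (pconcat p q).

Definition pa_one : A := \sum_(v : qvert Q) path_elt (ptriv v).

HB.instance Definition _ (f : qpath Q -> A) :=
  GRing.isZmodMorphism.Build A A (fglift f) (lift_is_additive f).

Lemma fgliftE (f : qpath Q -> A) x :
  fglift f x = \sum_(p <- dom x) coeff p x *: f p.
Proof.
rewrite -{1}[x]freeg_sumE raddf_sum.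
by apply: eq_bigr => p _; rewrite /= liftU.
Qed.

Lemma pa_mulE x y :
  pa_mul x y = fglift (fun p => fglift (fun q => opath_elt (pconcat p q)) y) x.
Proof.
rewrite fgliftE; apply: eq_bigr => p _; rewrite fgliftE scaler_sumr.
by apply: eq_bigr => q _; rewrite scalerA.
Qed.

Lemma freeg_scaleU (k : K) p : k *: path_elt p = << k *g p >>.
Proof. by apply/eqP/freeg_eqP => q; rewrite coeffZ !coeffU mul1r. Qed.

Lemma path_eltE x : x = \sum_(p <- dom x) coeff p x *: path_elt p.
Proof.
by rewrite -{1}[x]freeg_sumE; apply: eq_bigr => p _; rewrite freeg_scaleU.
Qed.

Lemma fgliftZ (f : qpath Q -> A) (k : K) x :
  fglift f (k *: x) = k *: fglift f x.
Proof.
rewrite [x in LHS]path_eltE scaler_sumr raddf_sum fgliftE scaler_sumr.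
by apply: eq_bigr => p _; rewrite /= scalerA freeg_scaleU liftU scalerA.
Qed.

Fact pa_mul0l : left_zero 0 pa_mul.
Proof. by move=> x; rewrite pa_mulE raddf0. Qed.

Fact pa_mul0r : right_zero 0 pa_mul.
Proof.
by move=> x; rewrite pa_mulE fgliftE big1 // => p _; rewrite raddf0 scaler0.
Qed.

Fact pa_mulDl : left_distributive pa_mul +%R.
Proof. by move=> x y z; rewrite !pa_mulE raddfD. Qed.

Fact pa_mulDr : right_distributive pa_mul +%R.
Proof.
move=> z x y; rewrite !pa_mulE !fgliftE -big_split; apply: eq_bigr => p _ /=.
by rewrite raddfD scalerDr.
Qed.

Fact pa_mulZl (k : K) x y : k *: pa_mul x y = pa_mul (k *: x) y.
Proof. by rewrite !pa_mulE fgliftZ. Qed.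

Fact pa_mulZr (k : K) x y : k *: pa_mul x y = pa_mul x (k *: y).
Proof.
rewrite !pa_mulE [in LHS]fgliftE [in RHS]fgliftE scaler_sumr.
by apply: eq_bigr => p _; rewrite fgliftZ !scalerA mulrC.
Qed.

Lemma pa_mul_path p q :
  pa_mul (path_elt p) (path_elt q) = opath_elt (pconcat p q).
Proof. by rewrite pa_mulE !liftU !scale1r. Qed.

Lemma pa_mul_opathl (o : option (qpath Q)) q :
  pa_mul (opath_elt o) (path_elt q) =
  opath_elt (obind (fun p => pconcat p q) o).
Proof. by case: o => [p|] /=; rewrite ?pa_mul_path ?pa_mul0l. Qed.

Lemma pa_mul_opathr p (o : option (qpath Q)) :
  pa_mul (path_elt p) (opath_elt o) = opath_elt (obind (pconcat p) o).
Proof. by case: o => [q|] /=; rewrite ?pa_mul_path ?pa_mul0r. Qed.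

Lemma path_elt_ind (P : A -> Prop) :
  P 0 -> (forall x y, P x -> P y -> P (x + y)) ->
  (forall (k : K) p, P (k *: path_elt p)) -> forall x, P x.
Proof. by move=> P0 PD PZ x; rewrite [x]path_eltE; elim/big_ind: _. Qed.

Fact pa_mulA : associative pa_mul.
Proof.
move=> x y z; elim/path_elt_ind: x => [|x x' IH IH'|a p].
- by rewrite 3!pa_mul0l.
- by rewrite 3!pa_mulDl IH IH'.
rewrite -!pa_mulZl; congr (_ *: _).
elim/path_elt_ind: y => [|y y' IH IH'|b q].
- by rewrite pa_mul0l pa_mul0r pa_mul0l.
- by rewrite pa_mulDl 2!pa_mulDr pa_mulDl IH IH'.
rewrite -!(pa_mulZl, pa_mulZr); congr (_ *: _).
elim/path_elt_ind: z => [|z z' IH IH'|c r].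
- by rewrite 3!pa_mul0r.
- by rewrite 3!pa_mulDr IH IH'.
rewrite -!pa_mulZr; congr (_ *: _).
by rewrite !pa_mul_path pa_mul_opathl pa_mul_opathr pconcatA.
Qed.

Lemma big_pred1_if (v : qvert Q) (y : A) :
  \sum_w (if v == w then y else 0) = y.
Proof. by rewrite -big_mkcond (big_pred1 v) // => w; rewrite eq_sym. Qed.

Fact pa_mul1l : left_id pa_one pa_mul.
Proof.
move=> x; elim/path_elt_ind: x => [|x y IH IH'|a p]; first exact: pa_mul0r.
  by rewrite pa_mulDr IH IH'.
rewrite -pa_mulZr; congr (_ *: _).
rewrite (big_morph (pa_mul^~ _) (fun _ _ => pa_mulDl _ _ _) (pa_mul0l _)).
rewrite -[RHS](big_pred1_if (psrc p)); apply: eq_bigr => v _.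
by rewrite pa_mul_path pconcat_trivl; case: ifP.
Qed.

Fact pa_mul1r : right_id pa_one pa_mul.
Proof.
move=> x; elim/path_elt_ind: x => [|x y IH IH'|a p]; first exact: pa_mul0l.
  by rewrite pa_mulDl IH IH'.
rewrite -pa_mulZl; congr (_ *: _).
rewrite (big_morph (pa_mul _) (fun _ _ => pa_mulDr _ _ _) (pa_mul0r _)).
rewrite -[RHS](big_pred1_if (ptgt p)); apply: eq_bigr => v _.
by rewrite pa_mul_path pconcat_trivr; case: ifP.
Qed.

End PathAlgebraMul.

Arguments path_elt K {Q} p.

Section PathAlgebra.
Variables (K : fieldType) (Q : quiver).

Definition path_algebra := {freeg (qpath Q) / K}.
HB.instance Definition _ := GRing.Lmodule.on path_algebra.
HB.instance Definition _ := GRing.Zmodule_isPzRing.Build path_algebra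
  (@pa_mulA K Q) (@pa_mul1l K Q) (@pa_mul1r K Q)
  (@pa_mulDl K Q) (@pa_mulDr K Q).

Lemma path_scalerAl (k : K) (x y : path_algebra) : k *: (x * y) = (k *: x) * y.
Proof. exact: pa_mulZl. Qed.
Lemma path_scalerAr (k : K) (x y : path_algebra) : k *: (x * y) = x * (k *: y).
Proof. exact: pa_mulZr. Qed.

Definition arrow_elt (a : qarrow Q) : path_algebra := path_elt K (parrow a).

Definition arrows_elt (s : seq (qarrow Q)) : path_algebra :=
  \prod_(a <- s) arrow_elt a.

End PathAlgebra.

Arguments arrow_elt K {Q} a.
Arguments arrows_elt K {Q} s.

Section QuotientAlgebra.
Variables (K : fieldType) (Q : quiver) (S : path_algebra K Q -> Prop).

Local Notation A := (path_algebra K Q).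

Definition ideal_pred : {pred A} := fun x => `[< ideal_generated S x >].

Fact ideal_pred_zmod_closed : zmod_closed ideal_pred.
Proof.
split=> [|x y /asboolP Sx /asboolP Sy]; apply/asboolP; first exact: ideal_0.
by apply: ideal_add => //; rewrite -mulN1r; apply: ideal_mull.
Qed.

HB.instance Definition _ :=
  GRing.isZmodClosed.Build A ideal_pred ideal_pred_zmod_closed.

(* KQ/I for the two-sided ideal I generated by S. The result is given the
   structures pzRingType and lmodType rather than algType because the latter
   also requires 1 != 0; compatibility is quot_scalerAl and quot_scalerAr. *)
Definition quotient_algebra := Quotient.quot ideal_pred.

HB.instance Definition _ := GRing.Zmodule.on quotient_algebra.

Definition quot_pi (x : A) : quotient_algebra :=
  (\pi_(Quotient.quot ideal_pred) x)%qT.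

Local Notation pi := quot_pi.
Local Notation qrepr := (@generic_quotient.repr A (Quotient.quot ideal_pred)).

Lemma pi_quotientP (x y : A) : pi x = pi y <-> ideal_generated S (x - y).
Proof.
split=> [/eqP|h]; first by rewrite -Quotient.idealrBE => /asboolP.
by apply/eqP; rewrite -Quotient.idealrBE; apply/asboolP.
Qed.

Definition quot_one : quotient_algebra := pi 1.
Definition quot_mul (x y : quotient_algebra) : quotient_algebra :=
  pi (qrepr x * qrepr y).
Definition quot_scale (k : K) (x : quotient_algebra) : quotient_algebra :=
  pi (k *: qrepr x).

Lemma pi_quotientK (x : quotient_algebra) : pi (qrepr x) = x.
Proof. exact: reprK. Qed.

Lemma pi_quotientD (x y : A) : pi (x + y) = pi x + pi y.
Proof. by rewrite [RHS]piE. Qed.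

Lemma pi_quotientM (x y : A) : pi (x * y) = quot_mul (pi x) (pi y).
Proof.
apply/pi_quotientP; set x' := qrepr _; set y' := qrepr _.
have -> : x * y - x' * y' = (x - x') * y + x' * (y - y').
  by rewrite mulrBl mulrBr addrA subrK.
by apply: ideal_add; [apply: ideal_mulr | apply: ideal_mull];
   apply/pi_quotientP; rewrite pi_quotientK.
Qed.

Lemma pi_quotientZ (k : K) (x : A) : pi (k *: x) = quot_scale k (pi x).
Proof.
apply/pi_quotientP; rewrite -scalerBr -[_ - _]mul1r path_scalerAl.
by apply: ideal_mull; apply/pi_quotientP; rewrite pi_quotientK.
Qed.

Fact quot_mulA : associative quot_mul.
Proof.
move=> x y z; rewrite -[x]pi_quotientK -[y]pi_quotientK -[z]pi_quotientK.
by rewrite -!pi_quotientM mulrA.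
Qed.
Fact quot_mul1l : left_id quot_one quot_mul.
Proof. by move=> x; rewrite -[x]pi_quotientK -pi_quotientM mul1r. Qed.
Fact quot_mul1r : right_id quot_one quot_mul.
Proof. by move=> x; rewrite -[x]pi_quotientK -pi_quotientM mulr1. Qed.
Fact quot_mulDl : left_distributive quot_mul +%R.
Proof.
move=> x y z; rewrite -[x]pi_quotientK -[y]pi_quotientK -[z]pi_quotientK.
by rewrite -pi_quotientD -!pi_quotientM mulrDl pi_quotientD.
Qed.
Fact quot_mulDr : right_distributive quot_mul +%R.
Proof.
move=> x y z; rewrite -[x]pi_quotientK -[y]pi_quotientK -[z]pi_quotientK.
by rewrite -pi_quotientD -!pi_quotientM mulrDr pi_quotientD.
Qed.

HB.instance Definition _ := GRing.Zmodule_isPzRing.Build quotient_algebra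
  quot_mulA quot_mul1l quot_mul1r quot_mulDl quot_mulDr.

Fact quot_scaleA (a b : K) (x : quotient_algebra) :
  quot_scale a (quot_scale b x) = quot_scale (a * b) x.
Proof. by rewrite -[x]pi_quotientK -!pi_quotientZ scalerA. Qed.
Fact quot_scale1 : left_id 1 quot_scale.
Proof. by move=> x; rewrite -[x]pi_quotientK -pi_quotientZ scale1r. Qed.
Fact quot_scaleDr : right_distributive quot_scale +%R.
Proof.
move=> a x y; rewrite -[x]pi_quotientK -[y]pi_quotientK.
by rewrite -pi_quotientD -!pi_quotientZ scalerDr pi_quotientD.
Qed.
Fact quot_scaleDl (x : quotient_algebra) :
  {morph quot_scale^~ x : a b / a + b}.
Proof.
move=> a b; rewrite -[x]pi_quotientK.
by rewrite -!pi_quotientZ scalerDl pi_quotientD.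
Qed.

HB.instance Definition _ := GRing.Zmodule_isLmodule.Build K quotient_algebra
  quot_scaleA quot_scale1 quot_scaleDr quot_scaleDl.

Lemma quot_scalerAl (k : K) (x y : quotient_algebra) :
  k *: (x * y) = (k *: x) * y.
Proof.
rewrite -[x]pi_quotientK -[y]pi_quotientK; change
  (quot_scale k (quot_mul (pi (qrepr x)) (pi (qrepr y))) =
   quot_mul (quot_scale k (pi (qrepr x))) (pi (qrepr y))).
by rewrite -!(pi_quotientZ, pi_quotientM) path_scalerAl.
Qed.
Lemma quot_scalerAr (k : K) (x y : quotient_algebra) :
  k *: (x * y) = x * (k *: y).
Proof.
rewrite -[x]pi_quotientK -[y]pi_quotientK; change
  (quot_scale k (quot_mul (pi (qrepr x)) (pi (qrepr y))) =
   quot_mul (pi (qrepr x)) (quot_scale k (pi (qrepr y)))).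
by rewrite -!(pi_quotientZ, pi_quotientM) path_scalerAr.
Qed.

End QuotientAlgebra.


Section Polygons.
Variables (T P : finType) (polygon : P -> {mset T}%mset).

Definition occ (a : T) (V : P) : nat := polygon V a.

Definition valency (a : T) : nat := (\sum_(V : P) occ a V)%N.

Definition occurrence (a : T) : finType := {V : P & 'I_(occ a V)}.

Lemma card_occurrence a : #|occurrence a| = valency a.
Proof.
by rewrite card_tagged sumnE big_map big_enum; apply: eq_bigr => V _;
   rewrite card_ord.
Qed.

End Polygons.

(* A cyclic ordering is encoded by its successor permutation. *)
Definition is_cyclic_order (X : finType) (s : {perm X}) : Prop :=
  forall x y, y \in porbit s x.

(* For at most two elements this is the only cyclic ordering, by
   is_cyclic_order_unique. *)
Definition enum_cycle (X : finType) : {perm X} :=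
  perm (can_inj (prev_next (enum_uniq X))).

Lemma enum_cycle_cyclic (X : finType) : is_cyclic_order (enum_cycle X).
Proof.
move=> x y; have : fconnect (next (enum X)) x y.
  by rewrite (fconnect_cycle (cycle_next (enum_uniq X))) mem_enum.
move/iter_findex => <-; apply/porbitP.
exists (findex (next (enum X)) x y); rewrite permX.
by apply: eq_iter => z; rewrite permE.
Qed.

Lemma is_cyclic_order_unique (X : finType) (s t : {perm X}) :
  (#|X| <= 2)%N -> is_cyclic_order s -> is_cyclic_order t -> s = t.
Proof.
move=> X2 cs ct; apply/permP => x.
have fixx (u : {perm X}) : is_cyclic_order u -> u x = x -> forall y, y = x.
  move=> cu ux y; have /porbitP[i ->] := cu x y.
  by rewrite permX; elim: i => //= i ->.
have [sx|/eqP sx] := eqVneq (s x) x; first by rewrite !(fixx s cs sx (_ x)).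
have [tx|/eqP tx] := eqVneq (t x) x; first by rewrite !(fixx t ct tx (_ x)).
have /card_le1_eqP : (#|[set~ x]| <= 1)%N.
  by rewrite cardsC1; case: #|X| X2 => [|[|[]]].
by apply; rewrite !inE; apply/eqP.
Qed.

Record brauer_config := BrauerConfig {
  bvert : finType;
  bpoly : finType;
  bpolygon : bpoly -> {mset bvert}%mset;
  bmult : bvert -> nat;
  borient : forall a, {perm occurrence bpolygon a};
  bmult_gt0 : forall a, (0 < bmult a)%N;
  borient_cyclic : forall a, is_cyclic_order (borient a);
  bvert_covered : forall a, exists V, (0 < occ bpolygon a V)%N;
  bpolygon_size : forall V, (1 < size (bpolygon V))%N;
  bpolygon_nontruncated : forall V,
    exists2 a, a \in bpolygon V & (1 < valency bpolygon a * bmult a)%N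
}.

Section BrauerAlgebra.
Variables (K : fieldType) (B : brauer_config).

Definition bval (a : bvert B) : nat := valency (@bpolygon B) a.

Definition truncated (a : bvert B) : bool := (bval a * bmult a == 1)%N.

(* The arrow a_r of the successor sequence V_1 < ... < V_t at a nontruncated
   vertex is identified with the r-th occurrence, i.e. with its starting point;
   it ends at the polygon of the next occurrence. *)
Definition barrow : finType :=
  {a : {a : bvert B | ~~ truncated a} & occurrence (@bpolygon B) (val a)}.

Definition barrow_vert (x : barrow) : bvert B := val (tag x).

Definition barrow_next (x : barrow) : barrow :=
  Tagged (fun a : {a : bvert B | ~~ truncated a} =>
            occurrence (@bpolygon B) (val a))
         (borient (val (tag x)) (tagged x)).

Definition barrow_src (x : barrow) : bpoly B := tag (tagged x).

Definition barrow_tgt (x : barrow) : bpoly B := barrow_src (barrow_next x).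

Definition brauer_quiver : quiver :=
  @Quiver (bpoly B) barrow barrow_src barrow_tgt.

(* The special cycle whose first arrow is x. *)
Definition special_cycle (x : barrow) : seq barrow :=
  traject barrow_next x (bval (barrow_vert x)).

Local Notation arr := (@arrow_elt K brauer_quiver).
Local Notation cyc x := (@arrows_elt K brauer_quiver (special_cycle x)).
Local Notation mu x := (bmult (barrow_vert x)).

Inductive brauer_relation : path_algebra K brauer_quiver -> Prop :=
| brauer_type_one (x y : barrow) of barrow_src x = barrow_src y :
    brauer_relation (cyc x ^+ mu x - cyc y ^+ mu y)
| brauer_type_two (x : barrow) :
    brauer_relation (cyc x ^+ mu x * arr x)
| brauer_type_three (x y : barrow) of
    barrow_tgt x = barrow_src y &
    (forall z, ~~ infix [:: x; y] (special_cycle z)) &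
    ~ [/\ x = y, barrow_src x = barrow_tgt x,
          bval (barrow_vert x) = 1%N & (1 < mu x)%N] :
    brauer_relation (arr x * arr y).

Definition brauer_algebra := quotient_algebra brauer_relation.

End BrauerAlgebra.

(* Finite undirected graphs on {0, ..., n-1}; a loop is an edge with only one
   endpoint, and distinct edges may have the same endpoints. *)
Record multigraph (n : nat) := MultiGraph {
  edge : finType;
  ends : edge -> {set 'I_n};
  card_ends : forall e, (0 < #|ends e| <= 2)%N
}.

Section Graph.
Variables (n : nat) (G : multigraph n).

Definition is_loop (e : edge G) : bool := #|ends e| == 1%N.

Definition edges_at (i : 'I_n) : {set edge G} := [set e | i \in ends e].

Definition no_isolated : Prop := forall i : 'I_n, edges_at i != set0.

(* [set i; j] = [set j; i], so that a non-loop edge yields two arrows and a loop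
   (i = j) yields one. *)
Definition garrow : finType :=
  {x : edge G * ('I_n * 'I_n) | ends x.1 == [set x.2.1; x.2.2]}.

Definition garrow_edge (a : garrow) : edge G := (val a).1.
Definition garrow_src (a : garrow) : 'I_n := (val a).2.1.
Definition garrow_tgt (a : garrow) : 'I_n := (val a).2.2.

Definition graph_quiver : quiver :=
  @Quiver 'I_n garrow garrow_src garrow_tgt.

(* ab is distinguished: b is the other arrow of the edge of a, or b = a if that
   edge is a loop. *)
Definition distinguished (a b : garrow) : bool :=
  [&& garrow_edge a == garrow_edge b, garrow_tgt a == garrow_src b
    & garrow_src a == garrow_tgt b].

End Graph.

Section CanonicalAlgebra.
Variables (K : fieldType) (n : nat) (G : multigraph n).

Local Notation arr := (@arrow_elt K (graph_quiver G)).

Inductive canonical_relation : path_algebra K (graph_quiver G) -> Prop :=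
| canonical_diff (a b c d : garrow G) of
    distinguished a b & distinguished c d &
    garrow_src a = garrow_src c & garrow_tgt b = garrow_tgt d :
    canonical_relation (arr a * arr b - arr c * arr d)
| canonical_cube (a b : garrow G) of distinguished a b :
    canonical_relation (arr a * arr b * arr a)
| canonical_nondistinguished (a b : garrow G) of
    garrow_tgt a = garrow_src b & ~~ distinguished a b :
    canonical_relation (arr a * arr b).

Definition canonical_algebra := quotient_algebra canonical_relation.

End CanonicalAlgebra.

Section GraphConfiguration.
Variables (n : nat) (G : multigraph n).

Definition adjacent (i j : 'I_n) : bool :=
  [exists e : edge G, ends e == [set i; j]].

Definition leaf_edge (i : 'I_n) (e : edge G) : bool :=
  (edges_at G i == [set e]) && ~~ is_loop e.

(* The connected component of i consists of i and of the single loop e. *)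
Definition lone_loop (i : 'I_n) (e : edge G) : bool :=
  [&& [set j | connect adjacent i j] == [set i], edges_at G i == [set e]
    & is_loop e].

Definition extra_vertex : finType :=
  {x : edge G * 'I_n | leaf_edge x.2 x.1 || lone_loop x.2 x.1}.

Definition gbvert : finType := (edge G + extra_vertex)%type.

Definition gpolygon_set (i : 'I_n) : {set gbvert} :=
  if [pick x : extra_vertex | (val x).2 == i] is Some x
  then [set inl (val x).1; inr x]
  else [set inl e | e in edges_at G i].

Definition gpolygon (i : 'I_n) : {mset gbvert}%mset :=
  seq_mset (enum (gpolygon_set i)).

Definition gmult (a : gbvert) : nat :=
  if a is inl e then (if is_loop e then 2 else 1)%N else 1%N.

Lemma occ_gpolygon (a : gbvert) i : occ gpolygon a i = (a \in gpolygon_set i).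
Proof.
by rewrite /occ /gpolygon mset_seqE count_uniq_mem ?enum_uniq // mem_enum.
Qed.

Lemma mem_gpolygon (a : gbvert) i : (a \in gpolygon i) = (a \in gpolygon_set i).
Proof. by rewrite (perm_mem (perm_eq_seq_mset _)) mem_enum. Qed.

Lemma edges_at_extra (x : extra_vertex) :
  edges_at G (val x).2 = [set (val x).1].
Proof. by case/orP: (valP x) => [/andP[/eqP]|/and3P[_ /eqP]]. Qed.

Lemma extra_vertex_inj (x y : extra_vertex) : (val x).2 = (val y).2 -> x = y.
Proof.
move=> exy; have e1 : (val x).1 = (val y).1.
  by apply/set1_inj; rewrite -!edges_at_extra exy.
by apply: val_inj; case: (val x) (val y) exy e1 => [? ?] [? ?] /= -> ->.
Qed.

Lemma edge_gpolygon e i : (inl e \in gpolygon_set i) = (i \in ends e).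
Proof.
rewrite /gpolygon_set; case: pickP => [x /eqP <-|_].
  have := edges_at_extra x => /setP/(_ e); rewrite !inE => ->.
  by rewrite orbF.
by rewrite mem_imset ?inE // => ? ? [].
Qed.

Lemma extra_gpolygon (x : extra_vertex) i :
  (inr x \in gpolygon_set i) = (i == (val x).2).
Proof.
rewrite /gpolygon_set; case: pickP => [y /eqP <-|/(_ x) nx].
  rewrite !inE /=; apply/eqP/eqP => [[->] //|/extra_vertex_inj -> //].
rewrite eq_sym nx; apply/negbTE/negP => /imsetP[] //.
Qed.

Lemma valency_edge e : valency gpolygon (inl e) = #|ends e|.
Proof.
rewrite -sum1_card big_mkcond; apply: eq_bigr => i _.
by rewrite occ_gpolygon edge_gpolygon; case: (_ \in _).
Qed.

Lemma valency_extra (x : extra_vertex) : valency gpolygon (inr x) = 1%N.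
Proof.
rewrite -(cards1 (val x).2) -sum1_card [RHS]big_mkcond; apply: eq_bigr => i _.
by rewrite occ_gpolygon extra_gpolygon inE; case: eqP.
Qed.

Lemma valency_gpolygon_le2 a : (valency gpolygon a <= 2)%N.
Proof.
case: a => [e|x]; last by rewrite valency_extra.
by rewrite valency_edge; case/andP: (card_ends e).
Qed.

Hypothesis G_no_isolated : no_isolated G.

Fact gmult_gt0 a : (0 < gmult a)%N.
Proof. by case: a => [e|x] //=; case: ifP. Qed.

Fact gvert_covered a : exists i, (0 < occ gpolygon a i)%N.
Proof.
case: a => [e|x]; last first.
  by exists (val x).2; rewrite occ_gpolygon extra_gpolygon eqxx.
have /andP[/card_gt0P[i ie] _] := card_ends e.
by exists i; rewrite occ_gpolygon edge_gpolygon ie.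
Qed.

Fact gpolygon_size i : (1 < size (gpolygon i))%N.
Proof.
rewrite (perm_size (perm_eq_seq_mset _)) -cardE /gpolygon_set.
case: pickP => [x _|nx]; first by rewrite cards2.
rewrite card_imset => [|? ? []//].
rewrite ltn_neqAle card_gt0 G_no_isolated andbT eq_sym.
apply/negP => /cards1P[e ate].
suff ok : leaf_edge i e || lone_loop i e.
  by have := nx (Sub (e, i) ok); rewrite SubK eqxx.
rewrite /leaf_edge /lone_loop ate eqxx /=.
case: (boolP (is_loop e)) => //= loope; rewrite andbT.
apply/eqP/setP => j; rewrite !inE.
apply/idP/eqP => [/connectP[p]|->]; last exact: connect0.
elim: p => [|k p IH] //= /andP[/existsP[f /eqP fE]].
suff -> : k = i by exact: IH.
have : f \in edges_at G i by rewrite inE fE set21.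
rewrite ate inE => /eqP fe; move: loope; rewrite -fe /is_loop fE cards2.
by case: (eqVneq i k).
Qed.

Fact gpolygon_nontruncated i :
  exists2 a, a \in gpolygon i & (1 < valency gpolygon a * gmult a)%N.
Proof.
have /set0Pn[e] := G_no_isolated i; rewrite inE => ie.
exists (inl e); first by rewrite mem_gpolygon edge_gpolygon.
rewrite valency_edge /= /is_loop; have := card_ends e.
by case: #|ends e| => [|[|[|]]].
Qed.

Definition brauer_of_graph : brauer_config :=
  @BrauerConfig gbvert 'I_n gpolygon gmult
    (fun a => enum_cycle (occurrence gpolygon a)) gmult_gt0
    (fun a => @enum_cycle_cyclic (occurrence gpolygon a))
    gvert_covered gpolygon_size gpolygon_nontruncated.

End GraphConfiguration.

(* Main.v *)
(* A truncated vertex of Gamma(G) carries no arrow, so an arrow of the Brauer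
   quiver is a pair (e, i) with i an endpoint of the edge e; sending it to the
   arrow of e that starts at i identifies Q_Gamma(G) with Q_G. For a non-loop
   edge the special cycles are aa' and a'a with mu = 1, for a loop the special
   cycle is b with mu = 2. Hence the elements C^mu are exactly the distinguished
   paths, and the exception in the relations of type three is what keeps b^2
   nonzero. The generators of the two ideals correspond, and so do the
   quotients. *)

From HB Require Import structures.
Require Import Defs.
From mathcomp Require Import all_boot all_fingroup all_algebra.
From mathcomp Require Import finmap multiset boolp freeg.

Set Implicit Arguments.
Unset Strict Implicit.
Unset Printing Implicit Defensive.

Import GRing.Theory.

Local Open Scope ring_scope.

(** * Quiver maps and their action on paths *)

Record quiver_map (Q Q' : quiver) := QuiverMap {
  qmap_vert : qvert Q -> qvert Q';
  qmap_arrow : qarrow Q -> qarrow Q';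
  qmap_src : forall a, qsrc (qmap_arrow a) = qmap_vert (qsrc a);
  qmap_tgt : forall a, qtgt (qmap_arrow a) = qmap_vert (qtgt a)
}.

Section PathMap.
Variables (Q Q' : quiver) (F : quiver_map Q Q').
Local Notation fv := (qmap_vert F).
Local Notation fa := (qmap_arrow F).

Fact is_walk_map v s : is_walk v s -> is_walk (fv v) (map fa s).
Proof.
by elim: s v => //= a s IH v /andP[/eqP <- /IH]; rewrite qmap_src qmap_tgt eqxx.
Qed.

Definition path_map (p : qpath Q) : qpath Q' :=
  @QPath Q' (fv p.1, map fa p.2) (is_walk_map (valP p)).

Lemma ptgt_path_map p : ptgt (path_map p) = fv (ptgt p).
Proof.
rewrite /ptgt /walk_end -[RHS]last_map -!map_comp; congr (last _ _).
by apply: eq_map => a /=; rewrite qmap_tgt.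
Qed.

(** Injectivity on vertices keeps non-composable paths non-composable, so zero products stay
    zero. *)
Lemma pconcat_path_map p q : injective fv ->
  pconcat (path_map p) (path_map q) = omap path_map (pconcat p q).
Proof.
move=> fv_inj; case: (pconcatP p q) => [r e rE|ne]; case: pconcatP => //=.
- move=> x _ xE; congr Some; apply: val_inj.
  rewrite [LHS]xE /= (rE : qpath_val r = _) /=.
  by rewrite map_cat.
- by case; rewrite ptgt_path_map e.
- by move=> x; rewrite ptgt_path_map => /fv_inj.
Qed.

End PathMap.

(* [path_elt_ind], with the operations taken from the structures of
   [path_algebra], to which the lemmas on linear maps apply syntactically. *)
Lemma path_algebra_ind (K : fieldType) (Q : quiver)
    (P : path_algebra K Q -> Prop) :
  P 0 -> (forall x y, P x -> P y -> P (x + y)) ->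
  (forall (k : K) p, P (k *: (path_elt K p : path_algebra K Q))) ->
  forall x, P x.
Proof. exact: path_elt_ind. Qed.

(** * The map of path algebras induced by a quiver map *)

Section PathAlgebraMap.
Variables (K : fieldType) (Q Q' : quiver) (F : quiver_map Q Q').
Local Notation fv := (qmap_vert F).

Definition path_algebra_map (x : path_algebra K Q) : path_algebra K Q' :=
  fglift (fun p => path_elt K (path_map F p)) x.

Fact path_algebra_map_zmod : zmod_morphism path_algebra_map.
Proof. exact: lift_is_additive. Qed.

HB.instance Definition _ := GRing.isZmodMorphism.Build
  (path_algebra K Q) (path_algebra K Q') path_algebra_map path_algebra_map_zmod.

Lemma path_algebra_map_elt (k : K) p :
  path_algebra_map (k *: (path_elt K p : path_algebra K Q)) =
  k *: (path_elt K (path_map F p) : path_algebra K Q').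
Proof.
by rewrite [X in path_algebra_map X]freeg_scaleU /path_algebra_map liftU.
Qed.

Fact path_algebra_map_scalable : scalable path_algebra_map.
Proof.
move=> k x; elim/path_algebra_ind: x => [|x y IHx IHy|c p].
- by rewrite scaler0 raddf0 scaler0.
- by rewrite (scalerDr k x y) !raddfD /= IHx IHy -scalerDr.
- by rewrite (scalerA k c) !path_algebra_map_elt scalerA.
Qed.

HB.instance Definition _ := GRing.isScalable.Build K
  (path_algebra K Q) (path_algebra K Q') *:%R path_algebra_map
  path_algebra_map_scalable.

Lemma path_algebra_map_linear : linear path_algebra_map.
Proof. by move=> k x y; rewrite linearP. Qed.

Lemma path_algebra_map_arrow a :
  path_algebra_map (arrow_elt K a) = arrow_elt K (qmap_arrow F a).
Proof.
rewrite /arrow_elt -[X in path_algebra_map X]scale1r path_algebra_map_elt.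
by rewrite scale1r; congr path_elt; apply: val_inj; rewrite /= qmap_src.
Qed.

Hypothesis fv_bij : bijective fv.

(** The unit is the sum of the trivial paths, and a bijection on vertices carries this sum to the
    one over [Q']. Products reduce by bilinearity to [pconcat_path_map]. *)
Lemma path_algebra_map_monoid : monoid_morphism path_algebra_map.
Proof.
have elt1 p : path_algebra_map (path_elt K p) = path_elt K (path_map F p).
  by rewrite -[X in path_algebra_map X]scale1r path_algebra_map_elt scale1r.
split=> [|x y].
  rewrite [1]/(pa_one K Q) /pa_one raddf_sum /= [RHS]/(pa_one K Q') /pa_one.
  rewrite (reindex fv) /=; last exact: onW_bij.
  apply: eq_bigr => v _; rewrite elt1; congr path_elt; exact: val_inj.
elim/path_algebra_ind: x => [|x x' IH IH'|a p].
- by rewrite mul0r raddf0 mul0r.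
- by rewrite mulrDl !raddfD /= mulrDl IH IH'.
rewrite -path_scalerAl !linearZ /= -path_scalerAl; congr (_ *: _).
elim/path_algebra_ind: y => [|y y' IH IH'|b q].
- by rewrite mulr0 raddf0 mulr0.
- by rewrite mulrDr !raddfD /= mulrDr IH IH'.
rewrite -path_scalerAr !linearZ /= -path_scalerAr; congr (_ *: _).
rewrite !elt1 ![_ * _]pa_mul_path (pconcat_path_map _ _ (bij_inj fv_bij)).
by case: (pconcat p q) => [r|] /=; rewrite ?elt1 ?raddf0.
Qed.

End PathAlgebraMap.

Lemma path_algebra_mapK (K : fieldType) (Q Q' : quiver)
    (F : quiver_map Q Q') (F' : quiver_map Q' Q) :
  cancel (qmap_vert F) (qmap_vert F') ->
  cancel (qmap_arrow F) (qmap_arrow F') ->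
  cancel (path_algebra_map F) (@path_algebra_map K _ _ F').
Proof.
move=> fvK faK x; elim/path_algebra_ind: x => [|x y IHx IHy|k p].
- by rewrite !raddf0.
- by rewrite !raddfD /= IHx IHy.
rewrite !path_algebra_map_elt; congr (_ *: path_elt K _).
by apply: val_inj; rewrite /= fvK mapK //; case: (val p).
Qed.

(** * Descent of algebra maps to quotients *)

Lemma ideal_generated_morph (R R' : pzRingType) (f : {rmorphism R -> R'})
    (S : R -> Prop) (S' : R' -> Prop) :
  (forall x, S x -> ideal_generated S' (f x)) ->
  forall x, ideal_generated S x -> ideal_generated S' (f x).
Proof.
move=> SS' x; elim=> {x} [x /SS' //||x y _ IHx _ IHy|a x _ IHx|x a _ IHx].
- by rewrite rmorph0; apply: ideal_0.
- by rewrite rmorphD; apply: ideal_add.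
- by rewrite rmorphM; apply: ideal_mull.
- by rewrite rmorphM; apply: ideal_mulr.
Qed.

Section QuotientMap.
Variables (K : fieldType) (Q Q' : quiver).
Variables (S : path_algebra K Q -> Prop) (S' : path_algebra K Q' -> Prop).
Variable f : path_algebra K Q -> path_algebra K Q'.
Hypotheses (f_linear : linear f) (f_monoid : monoid_morphism f).
Hypothesis f_rel : forall x, S x -> S' (f x).

HB.instance Definition _ := GRing.isLinear.Build K
  (path_algebra K Q) (path_algebra K Q') *:%R f f_linear.
HB.instance Definition _ := GRing.isMonoidMorphism.Build
  (path_algebra K Q) (path_algebra K Q') f f_monoid.

Definition quot_map (x : quotient_algebra S) : quotient_algebra S' :=
  quot_pi S' (f (generic_quotient.repr x)).

(** The chosen representative of the class of [x] differs from [x] by an element of the ideal of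
    [S], which [f] sends into the ideal of [S']. So the choice made in [quot_map] is immaterial. *)
Lemma quot_map_pi x : quot_map (quot_pi S x) = quot_pi S' (f x).
Proof.
apply/pi_quotientP; rewrite -raddfB /=.
apply: (@ideal_generated_morph _ _ f S).
  by move=> y /f_rel; apply: ideal_gen.
by apply/pi_quotientP; rewrite pi_quotientK.
Qed.

Lemma quot_map_linear : linear quot_map.
Proof.
move=> k x y; rewrite -[x]pi_quotientK -[y]pi_quotientK.
rewrite -[k *: _]pi_quotientZ -pi_quotientD !quot_map_pi linearP /=.
by rewrite pi_quotientD pi_quotientZ.
Qed.

Lemma quot_map_monoid : monoid_morphism quot_map.
Proof.
split=> [|x y]; first by rewrite [1]/(quot_pi S 1) quot_map_pi rmorph1.
rewrite -[x]pi_quotientK -[y]pi_quotientK.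
by rewrite -[_ * _]pi_quotientM !quot_map_pi rmorphM /= [LHS]pi_quotientM.
Qed.

End QuotientMap.

Lemma quot_mapK (K : fieldType) (Q Q' : quiver)
    (S : path_algebra K Q -> Prop) (S' : path_algebra K Q' -> Prop)
    (f : path_algebra K Q -> path_algebra K Q')
    (g : path_algebra K Q' -> path_algebra K Q) :
  linear f -> monoid_morphism f -> (forall x, S x -> S' (f x)) ->
  linear g -> monoid_morphism g -> (forall x, S' x -> S (g x)) ->
  cancel f g -> cancel (@quot_map K Q Q' S S' f) (@quot_map K Q' Q S' S g).
Proof.
move=> f_lin f_mon fS g_lin g_mon gS fK x; rewrite -[x in LHS]pi_quotientK.
by rewrite !quot_map_pi // fK pi_quotientK.
Qed.

(** * Two-letter words and cyclic orders on at most two points *)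

Lemma infix_pair (T : eqType) (x y z t : T) :
  infix [:: x; y] [:: z; t] = (x == z) && (y == t).
Proof. by rewrite /= !andbT !andbF !orbF. Qed.

(** If [s] fixed [x], the orbit of [x] would be [x] alone, forcing [y = x]. The case [x = y] is
    allowed, so loops and non-loop edges are treated alike. *)
Lemma cyclic_order_pair (X : finType) (s : {perm X}) x y :
  is_cyclic_order s -> (forall z, z = x \/ z = y) -> s x = y.
Proof.
move=> s_cyc xy; have [sx|//] := xy (s x).
have /porbitP[k ->] := s_cyc x y; rewrite permX.
by elim: k => [|k IH] //=; rewrite -IH !sx.
Qed.

(** * The bijection between graph arrows and Brauer arrows *)

Section ArrowBijection.
Variables (n : nat) (G : multigraph n).

Fact garrow_rev_subproof (a : garrow G) :
  ends (garrow_edge a) == [set garrow_tgt a; garrow_src a].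
Proof. by rewrite setUC (valP a). Qed.

(** A loop is its own reverse, so [a] followed by [garrow_rev a] is $aa'$ for a non-loop edge and
    $b^2$ for a loop. *)
Definition garrow_rev (a : garrow G) : garrow G :=
  Sub (garrow_edge a, (garrow_tgt a, garrow_src a)) (garrow_rev_subproof a).

Lemma garrow_eq (a b : garrow G) : garrow_edge a = garrow_edge b ->
  garrow_src a = garrow_src b -> garrow_tgt a = garrow_tgt b -> a = b.
Proof.
case: a b => [[e [i j]] ha] [[e' [i' j']] hb].
rewrite /garrow_edge /garrow_src /garrow_tgt /= => eqe eqi eqj.
by apply: val_inj; rewrite /= eqe eqi eqj.
Qed.

Lemma distinguishedE (a b : garrow G) : distinguished a b = (b == garrow_rev a).
Proof.
apply/and3P/eqP => [[/eqP e /eqP st /eqP ts]|->]; last by rewrite !eqxx.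
exact/esym/garrow_eq.
Qed.

Lemma src_in_ends (a : garrow G) : garrow_src a \in ends (garrow_edge a).
Proof. by rewrite (eqP (valP a)) set21. Qed.

Lemma in_endsP (a : garrow G) i : i \in ends (garrow_edge a) ->
  i = garrow_src a \/ i = garrow_tgt a.
Proof. by rewrite (eqP (valP a)) => /set2P. Qed.

Lemma is_loopE (a : garrow G) :
  is_loop (garrow_edge a) = (garrow_src a == garrow_tgt a).
Proof. by rewrite /is_loop (eqP (valP a)) cards2 eqSS eqb0 negbK. Qed.

(** The target is the element of [ends e] left after removing [i], or [i] itself if none is left. *)
Lemma ends_garrow e i : i \in ends e ->
  exists a : garrow G, garrow_edge a = e /\ garrow_src a = i.
Proof.
move=> ie; have [j ej] : exists j, ends e = [set i; j].
  have := card_ends e; rewrite (cardsD1 i) ie => /andP[_].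
  rewrite ltnS leq_eqVlt => /orP[/cards1P[j ej]|].
    by exists j; rewrite -(setD1K ie) ej.
  rewrite ltnS leqn0 cards_eq0 => /eqP e0; exists i.
  by rewrite -(setD1K ie) e0 setU0 setUid.
by exists (Sub (e, (i, j)) (introT eqP ej)).
Qed.

Hypothesis G_no_isolated : no_isolated G.
Let B := brauer_of_graph G_no_isolated.

Lemma bval_edge e : @bval B (inl e) = #|ends e|.
Proof. exact: valency_edge. Qed.

(** Valency times multiplicity is always 2: $1\cdot 2$ for a loop, $2\cdot 1$ for a non-loop
    edge. *)
Fact edge_nontruncated e : ~~ @truncated B (inl e).
Proof.
rewrite /truncated bval_edge /= /is_loop; have := card_ends e.
by case: #|ends e| => [|[|[|]]].
Qed.

Fact extra_truncated x : @truncated B (inr x).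
Proof. by rewrite /truncated /bval valency_extra. Qed.

Fact occ_src_gt0 (a : garrow G) :
  (0 < occ (@bpolygon B) (inl (garrow_edge a)) (garrow_src a))%N.
Proof. by rewrite occ_gpolygon edge_gpolygon src_in_ends. Qed.

Definition src_occurrence (a : garrow G) :
    occurrence (@bpolygon B) (inl (garrow_edge a)) :=
  Tagged (fun i => 'I_(occ (@bpolygon B) (inl (garrow_edge a)) i))
    (Ordinal (occ_src_gt0 a)).

(** The ascription retypes the occurrence over the value of the nontruncated vertex, which reduces
    to [inl (garrow_edge a)]. *)
Definition brauer_arrow (a : garrow G) : barrow B :=
  Tagged (fun x : {x : bvert B | ~~ truncated x} =>
            occurrence (@bpolygon B) (val x))
    (src_occurrence a : occurrence (@bpolygon B)
       (val (Sub (inl (garrow_edge a)) (edge_nontruncated _) :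
               {x : bvert B | ~~ truncated x}))).

Lemma brauer_arrow_src a : barrow_src (brauer_arrow a) = garrow_src a.
Proof. by []. Qed.

Lemma brauer_arrow_vert a : barrow_vert (brauer_arrow a) = inl (garrow_edge a).
Proof. by []. Qed.

(** The polygons of $\Gamma(G)$ are sets, so the index of an occurrence lives in an ordinal type
    with at most one element. *)
Lemma occurrence_eq x (o o' : occurrence (@bpolygon B) x) :
  tag o = tag o' -> o = o'.
Proof.
case: o o' => [i k] [i' k'] /= ei; case: _ / ei k' => k'.
congr existT; apply: val_inj.
have : (occ (@bpolygon B) x i <= 1)%N by rewrite occ_gpolygon leq_b1.
case: k k' => k hk [k' hk'] /= le1.
move: (leq_trans hk le1) (leq_trans hk' le1).
by case: k {hk} k' {hk'} => [|?] [|?].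
Qed.

Lemma barrow_eq (x y : barrow B) :
  barrow_vert x = barrow_vert y -> barrow_src x = barrow_src y -> x = y.
Proof.
case: x y => [[u hu] o] [[v hv] o']; rewrite /barrow_vert /barrow_src /= => uv.
case: _ / uv hv o' => hv o' /occurrence_eq ->.
by rewrite (bool_irrelevance hu hv).
Qed.

Lemma brauer_arrow_inj : injective brauer_arrow.
Proof.
move=> a b ab.
have eqe : garrow_edge a = garrow_edge b.
  by have := congr1 (@barrow_vert B) ab; rewrite !brauer_arrow_vert => -[].
have eqs : garrow_src a = garrow_src b by rewrite -!brauer_arrow_src ab.
apply: garrow_eq => //.
have endsab :
    [set garrow_src a; garrow_tgt a] = [set garrow_src a; garrow_tgt b].
  by rewrite [in RHS]eqs -(eqP (valP a)) -(eqP (valP b)); congr ends.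
(* Otherwise the edge is a loop, and the target of [b] is then the common source as well. *)
have /set2P[tb|//] : garrow_tgt a \in [set garrow_src a; garrow_tgt b].
  by rewrite -endsab set22.
have : garrow_tgt b \in [set garrow_src a; garrow_tgt a].
  by rewrite endsab set22.
by rewrite tb setUid inE => /eqP.
Qed.

Lemma occurrence_ends e (o : occurrence (@bpolygon B) (inl e)) :
  tag o \in ends e.
Proof.
have := leq_ltn_trans (leq0n _) (ltn_ord (tagged o)).
by rewrite occ_gpolygon edge_gpolygon; case: (_ \in _).
Qed.

(** Extra vertices are truncated, so every Brauer arrow sits at an edge and starts at one of its
    endpoints. *)
Lemma brauer_arrow_surj x : exists a, brauer_arrow a == x.
Proof.
case: x => [[[e|y] h] o]; last by have := h; rewrite extra_truncated.
have /ends_garrow[a [ae ai]] := occurrence_ends o.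
by exists a; apply/eqP/barrow_eq; rewrite ?brauer_arrow_vert ?ae.
Qed.

Definition graph_arrow (x : barrow B) : garrow G :=
  xchoose (brauer_arrow_surj x).

Lemma graph_arrowK : cancel graph_arrow brauer_arrow.
Proof. by move=> x; apply/eqP/(xchooseP (brauer_arrow_surj x)). Qed.

Lemma brauer_arrowK : cancel brauer_arrow graph_arrow.
Proof. by move=> a; apply: brauer_arrow_inj; rewrite graph_arrowK. Qed.

(** The only occurrences of the edge are at the source and the target of [a], so [cyclic_order_pair]
    determines the successor. *)
Lemma barrow_next_brauer a :
  barrow_next (brauer_arrow a) = brauer_arrow (garrow_rev a).
Proof.
apply: barrow_eq => //.
apply: (congr1 tag (cyclic_order_pair (y := src_occurrence (garrow_rev a))
  (@borient_cyclic B (inl (garrow_edge a))) _)).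
move=> o; have /in_endsP := occurrence_ends o.
(* The endpoints are read off [garrow_rev a], whose source gives the second alternative. *)
by case=> oE; [right | left]; apply: occurrence_eq.
Qed.

Lemma brauer_arrow_tgt a : barrow_tgt (brauer_arrow a) = garrow_tgt a.
Proof. by rewrite /barrow_tgt barrow_next_brauer. Qed.

Lemma graph_arrow_src x : garrow_src (graph_arrow x) = barrow_src x.
Proof. by rewrite -brauer_arrow_src graph_arrowK. Qed.

Lemma graph_arrow_tgt x : garrow_tgt (graph_arrow x) = barrow_tgt x.
Proof. by rewrite -brauer_arrow_tgt graph_arrowK. Qed.

Lemma distinguished_graph_arrow x y :
  distinguished (graph_arrow x) (graph_arrow y) = (y == barrow_next x).
Proof.
rewrite distinguishedE -(inj_eq brauer_arrow_inj) -barrow_next_brauer.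
by rewrite !graph_arrowK.
Qed.

Lemma barrow_next_tgt (x : barrow B) :
  barrow_tgt (barrow_next x) = barrow_src x.
Proof.
rewrite -[x]graph_arrowK; move: (graph_arrow x) => a.
by rewrite barrow_next_brauer brauer_arrow_tgt.
Qed.

(** * Inverse quiver maps and the correspondence of relations *)

Definition graph_to_brauer : quiver_map (graph_quiver G) (brauer_quiver B) :=
  @QuiverMap (graph_quiver G) (brauer_quiver B) id brauer_arrow
    brauer_arrow_src brauer_arrow_tgt.

Definition brauer_to_graph : quiver_map (brauer_quiver B) (graph_quiver G) :=
  @QuiverMap (brauer_quiver B) (graph_quiver G) id graph_arrow
    graph_arrow_src graph_arrow_tgt.

Fact graph_to_brauer_bij : bijective (qmap_vert graph_to_brauer).
Proof. by exists id. Qed.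

Fact brauer_to_graph_bij : bijective (qmap_vert brauer_to_graph).
Proof. by exists id. Qed.

Lemma special_cycle_brauer a : special_cycle (brauer_arrow a) =
  if is_loop (garrow_edge a) then [:: brauer_arrow a]
  else [:: brauer_arrow a; brauer_arrow (garrow_rev a)].
Proof.
rewrite /special_cycle brauer_arrow_vert bval_edge.
have := card_ends (garrow_edge a); rewrite /is_loop.
by case: #|_| => [|[|[|]]] //= _; rewrite barrow_next_brauer.
Qed.

(** A loop has a cycle of length 1 raised to the power 2, and is its own successor; a non-loop edge
    has a cycle of length 2 raised to the power 1. This one formula then serves both kinds of
    edge. *)
Lemma special_cycle_expE (K : fieldType) x :
  @arrows_elt K (brauer_quiver B) (special_cycle x) ^+ bmult (barrow_vert x) =
  @arrow_elt K (brauer_quiver B) x *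
  @arrow_elt K (brauer_quiver B) (barrow_next x).
Proof.
rewrite -[x]graph_arrowK; move: (graph_arrow x) => a.
rewrite special_cycle_brauer barrow_next_brauer brauer_arrow_vert /=.
rewrite /arrows_elt; case: ifP => [|_].
  rewrite is_loopE big_seq1 expr2 => /eqP st; congr (_ * arrow_elt K _).
  by congr brauer_arrow; apply: garrow_eq.
by rewrite expr1 big_cons big_seq1.
Qed.

(** The path from an arrow to its successor lies in a special cycle if the edge is not a loop, and
    is the exception of type three if it is. No other path of length two is of either kind. *)
Lemma type_three_iff (x y : barrow B) :
  (forall z, ~~ infix [:: x; y] (special_cycle z)) /\
    ~ [/\ x = y, barrow_src x = barrow_tgt x,
          bval (barrow_vert x) = 1%N & (1 < bmult (barrow_vert x))%N]
  <-> y != barrow_next x.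
Proof.
rewrite -[x]graph_arrowK -[y]graph_arrowK.
move: (graph_arrow x) (graph_arrow y) => a b.
rewrite barrow_next_brauer brauer_arrow_tgt.
split=> [[noinf exc]|nba].
  apply/negP => /eqP eb; case: (boolP (is_loop (garrow_edge a))) => la.
    have st := la; rewrite is_loopE in st; move/eqP: st => st.
    apply: exc; split => //.
    - by rewrite eb; congr brauer_arrow; apply: garrow_eq.
    - by rewrite brauer_arrow_vert bval_edge; apply/eqP.
    - by rewrite brauer_arrow_vert /= la.
  have := noinf (brauer_arrow a).
  by rewrite special_cycle_brauer (negbTE la) eb infix_refl.
split=> [z|[eab st]].
  rewrite -[z]graph_arrowK; move: (graph_arrow z) => c.
  rewrite special_cycle_brauer; case: ifP => _.
    (* The special cycle of a loop has one arrow, too few to contain a path of length two. *)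
    by apply/negP => /size_infix.
  apply: contra nba; rewrite infix_pair.
  by case/andP => /eqP/brauer_arrow_inj ->.
(* An arrow with equal source and target is its own reverse, so [x = y] would make [y] the successor
   of [x]. *)
move=> v1 _; move/negP: nba; apply; apply/eqP; rewrite -eab.
congr brauer_arrow; exact: garrow_eq.
Qed.

(** Generators go to generators: types one, two and three to differences, cubes and
    non-distinguished paths. In type one, an arrow followed by its successor returns to its source,
    so equal sources also give the equal targets that [canonical_diff] asks for. *)
Lemma brauer_to_graph_relation (K : fieldType) z :
  @brauer_relation K B z ->
  canonical_relation (path_algebra_map brauer_to_graph z).
Proof.
have [_ phiM] := @path_algebra_map_monoid K _ _ _ brauer_to_graph_bij.
case=> {z} [x y xy|x|x y xy noinf exc].
- rewrite raddfB !special_cycle_expE /= !phiM !path_algebra_map_arrow.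
  apply: canonical_diff; rewrite ?distinguished_graph_arrow //.
    by rewrite !graph_arrow_src.
  by rewrite !graph_arrow_tgt !barrow_next_tgt.
- rewrite special_cycle_expE !phiM !path_algebra_map_arrow.
  by apply: canonical_cube; rewrite distinguished_graph_arrow.
- rewrite phiM !path_algebra_map_arrow; apply: canonical_nondistinguished.
    by rewrite /= graph_arrow_tgt graph_arrow_src.
  by rewrite distinguished_graph_arrow; apply/type_three_iff.
Qed.

Lemma graph_to_brauer_relation (K : fieldType) z :
  @canonical_relation K n G z ->
  brauer_relation (path_algebra_map graph_to_brauer z).
Proof.
have [_ psiM] := @path_algebra_map_monoid K _ _ _ graph_to_brauer_bij.
(* Every distinguished path maps to the power $C^{\mu}$ of the special cycle starting with its first
   arrow. *)
have arrM (a b : garrow G) : distinguished a b ->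
  path_algebra_map graph_to_brauer
    (@arrow_elt K (graph_quiver G) a * @arrow_elt K (graph_quiver G) b) =
  @arrows_elt K (brauer_quiver B) (special_cycle (brauer_arrow a))
    ^+ bmult (barrow_vert (brauer_arrow a)).
  rewrite distinguishedE => /eqP ->.
  by rewrite psiM !path_algebra_map_arrow special_cycle_expE barrow_next_brauer.
case=> {z} [a b c d ab cd ac bd|a b ab|a b ab nab].
- by rewrite raddfB /= !arrM //; apply: brauer_type_one.
- by rewrite psiM arrM // path_algebra_map_arrow; apply: brauer_type_two.
rewrite psiM !path_algebra_map_arrow.
have [|noinf exc] := (type_three_iff (brauer_arrow a) (brauer_arrow b)).2.
  by rewrite barrow_next_brauer (inj_eq brauer_arrow_inj) -distinguishedE.
by apply: brauer_type_three => //; rewrite brauer_arrow_tgt.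
Qed.

End ArrowBijection.

Theorem theorem4p6 (K : fieldType) (n : nat) (n_ge1 : (1 <= n)%N)
    (G : multigraph n) (G_no_isolated : no_isolated G) :
  exists f : {linear brauer_algebra K (brauer_of_graph G_no_isolated)
                -> canonical_algebra K G},
    GRing.monoid_morphism f /\ bijective f.
Proof.
pose phi := @path_algebra_map K _ _ (brauer_to_graph G_no_isolated).
pose psi := @path_algebra_map K _ _ (graph_to_brauer G_no_isolated).
have phi_lin : linear phi by exact: path_algebra_map_linear.
have psi_lin : linear psi by exact: path_algebra_map_linear.
have phi_mon : monoid_morphism phi.
  exact: path_algebra_map_monoid (brauer_to_graph_bij _).
have psi_mon : monoid_morphism psi.
  exact: path_algebra_map_monoid (graph_to_brauer_bij _).
have phi_rel := @brauer_to_graph_relation n G G_no_isolated K.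
have psi_rel := @graph_to_brauer_relation n G G_no_isolated K.
pose RB := @brauer_relation K (brauer_of_graph G_no_isolated).
pose RG := @canonical_relation K n G.
pose f : brauer_algebra K (brauer_of_graph G_no_isolated) ->
  canonical_algebra K G := @quot_map K _ _ RB RG phi.
have f_linear : linear f by apply: quot_map_linear.
pose fL : {linear _ -> _} :=
  HB.pack f (GRing.isLinear.Build K _ _ *:%R f f_linear).
exists fL; split; first exact: quot_map_monoid.
(* The inverse is induced by [psi]: the quiver maps are the identity on vertices and mutually
   inverse on arrows. *)
exists (@quot_map K _ _ RG RB psi); apply: quot_mapK => //;
  apply: path_algebra_mapK => //; [exact: graph_arrowK | exact: brauer_arrowK].
Qed.
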